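(* Consider action-controlled hidden Markov models with finite action set $\mathcal A$ and transition matrices $$T(a)=P(a)+\varepsilon Q(a),\qquad a\in\mathcal A,$$ where the permutation matrices $P(a)\in\mathbb R^{N\times N}$, the matrices $Q(a)$, the emission matrix $E$, the initial distribution $\pi_0$ and the initial vector $w_0$ are fixed and $\varepsilon>0$ is small. Assume that $\|w_0\|<\infty$, that all entries of $E$ are strictly positive, and that no two columns of $E$ are identical. For each $\varepsilon$ let $\delta_\varepsilon\in(0,1)$, let $\boldsymbol w_k$ be generated by the time-varying adaptive logit filter $$\boldsymbol w_k=P(\boldsymbol a_{k-1})(1-\delta_\varepsilon)\boldsymbol w_{k-1}+\delta_\varepsilon\log(E^\top\boldsymbol y_k),\qquad k\ge1,$$ started at $w_0$, and let $p_k=\mathbb P\big[\arg\max_{x\in\mathcal X}\boldsymbol w_k(x)\ne\boldsymbol x_k^\star\big]$. (a) If $\lim_{\varepsilon\to0}\delta_\varepsilon=0$ and $\lim_{\varepsilon\to0}\varepsilon/\delta_\varepsilon=0$, then $$\lim_{\varepsilon\to0}\limsup_{k\to\infty}p_k=0.$$ (b) There is a constant $\xi>0$, depending only on the permutation matrices $\{P(a)\}_{a\in\mathcal A}$ and on $E$, such that if $\delta_\varepsilon=\lambda/\log(1/\varepsilon)$ with $\lambda\in(0,\xi)$, then for some constant $\kappa>0$ independent of $\varepsilon$, as $\varepsilon\to0$, $$\limsup_{k\to\infty}p_k\le\kappa\,\varepsilon\log\frac1\varepsilon+o\Big(\varepsilon\log\frac1\varepsilon\Big).$$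
   Context: Action-controlled hidden Markov model: state space $\mathcal X=\{x_1,\dots,x_N\}$, $\boldsymbol x_0^\star\sim\pi_0$; $t_{ij}(a)=\mathbb P(\boldsymbol x^\star_{k+1}=x_i\mid\boldsymbol x_k^\star=x_j,\boldsymbol a_k=a)$, the next state being conditionally independent of the rest of the past given current state and action; observations $\boldsymbol y_k\in\{u_1,\dots,u_S\}$ (canonical basis vectors of $\mathbb R^S$), $k\ge1$, emitted with $e_{ij}=\mathbb P(\boldsymbol y_k=u_i\mid\boldsymbol x_k^\star=x_j)$, conditionally independently of the rest of the past given $\boldsymbol x_k^\star$. The action $\boldsymbol a_k$ is chosen by an agent on the basis of the past observations and actions $(\boldsymbol y_{1:k},\boldsymbol a_{0:k-1})$ (possibly randomly). Each $Q(a)$ satisfies: with $n_j(a)$ the row index of the unique $1$ in column $j$ of $P(a)$, $q_{ij}(a)\ge0$ for $i\ne n_j(a)$ and $q_{n_j(a)j}(a)=-\sum_{i\ne n_j(a)}q_{ij}(a)$; $\varepsilon$ is small enough that each $T(a)$ is a column-stochastic matrix. $\log$ is entrywise, $\boldsymbol w_k(x_i)$ is the $i$-th entry of $\boldsymbol w_k$, and ties in $\arg\max$ may be broken arbitrarily. *)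

(* Defs.v *)
From HB Require Import structures.
From mathcomp Require Import all_boot all_order all_algebra.
From mathcomp Require Import all_classical all_reals all_analysis.

Set Implicit Arguments.
Unset Strict Implicit.
Unset Printing Implicit Defensive.

Import Order.TTheory GRing.Theory Num.Theory.
Import numFieldNormedType.Exports.

Local Open Scope classical_set_scope.
Local Open Scope ring_scope.

Definition column_stochastic (R : realType) (m n : nat) (B : 'M[R]_(m, n)) :
    Prop :=
  (forall i j, 0 <= B i j) /\ (forall j, \sum_(i < m) B i j = 1).

(* Sign and zero-column-sum conditions on Q relative to the permutation matrix
   P: the row n_j is the one with P n_j j = 1. *)
Definition perturbation_of (R : realType) (N : nat) (P Q : 'M[R]_N) : Prop :=
  (forall i j, P i j != 1 -> 0 <= Q i j) /\
  (forall n j, P n j = 1 -> Q n j = - \sum_(i < N | i != n) Q i j).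

(* T_eps = P + eps Q; entry (i, j) is the probability of moving from j to i. *)
Definition transition (R : realType) (N : nat) (A : finType)
    (P Q : A -> 'M[R]_N) (eps : R) (a : A) : 'M[R]_N :=
  P a + eps *: Q a.

(* State x_k is an index in 'I_N; the observation in {u_1, ..., u_S} is given
   by the index of the basis vector.  obs 0 plays no role: observations start
   at time 1. *)
Record process (R : realType) (N S : nat) (A : finType) := Process {
  disp : measure_display;
  Omega : measurableType disp;
  prob : probability Omega R;
  state : nat -> Omega -> 'I_N;
  obs : nat -> Omega -> 'I_S;
  act : nat -> Omega -> A
}.
Arguments state {R N S A} M k w : rename.
Arguments obs {R N S A} M k w : rename.
Arguments act {R N S A} M k w : rename.

Definition rv_measurable d (Om : measurableType d) (V : Type)
    (X : nat -> Om -> V) : Prop :=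
  forall k v, measurable (X k @^-1` [set v]).

(* The event x_{0:k} = xs, y_{1:m} = ys, a_{0:n-1} = acts. *)
Definition history (R : realType) (N S : nat) (A : finType)
    (M : process R N S A) (k m n : nat)
    (xs : nat -> 'I_N) (ys : nat -> 'I_S) (acts : nat -> A) : set (Omega M) :=
  [set w | [/\ (forall l, (l <= k)%N -> state M l w = xs l),
               (forall l, (1 <= l <= m)%N -> obs M l w = ys l) &
               (forall l, (l < n)%N -> act M l w = acts l)]].

(* Junk value when prob M B = 0; only used under 0 < prob M B. *)
Definition cond_prob (R : realType) (N S : nat) (A : finType)
    (M : process R N S A) (F B : set (Omega M)) : R :=
  fine (prob M (F `&` B)) / fine (prob M B).

(* A randomized policy: mu ys acts a is the probability of choosing a after
   the observations ys = [y_1; ...; y_k] and actions acts = [a_0; ...; a_{k-1}]. *)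
Definition is_policy (R : realType) (S : nat) (A : finType)
    (mu : seq 'I_S -> seq A -> A -> R) : Prop :=
  forall ys acts, (forall a, 0 <= mu ys acts a) /\ \sum_(a : A) mu ys acts a = 1.

(* The time-k+1 chronology is: a_k, then x_{k+1}, then y_{k+1}; each variable
   is conditioned on everything that precedes it. *)
Record is_hmm (R : realType) (N S : nat) (A : finType)
    (T : A -> 'M[R]_N) (E : 'M[R]_(S, N)) (pi0 : 'cV[R]_N)
    (M : process R N S A) : Prop := IsHmm {
  state_measurable : rv_measurable (state M);
  obs_measurable : rv_measurable (obs M);
  act_measurable : rv_measurable (act M);
  init_law : forall i, prob M (state M 0 @^-1` [set i]) = (pi0 i 0)%:E;
  act_law : exists2 mu : seq 'I_S -> seq A -> A -> R, is_policy mu &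
    forall k xs ys acts, (0 < prob M (history k k k xs ys acts))%E ->
    forall a, cond_prob (act M k @^-1` [set a]) (history k k k xs ys acts) =
              mu (mkseq (fun l => ys l.+1) k) (mkseq acts k) a;
  state_law : forall k xs ys acts,
    (0 < prob M (history k k k.+1 xs ys acts))%E ->
    forall i, cond_prob (state M k.+1 @^-1` [set i])
                        (history k k k.+1 xs ys acts) =
              T (acts k) i (xs k);
  obs_law : forall k xs ys acts,
    (0 < prob M (history k.+1 k k.+1 xs ys acts))%E ->
    forall i, cond_prob (obs M k.+1 @^-1` [set i])
                        (history k.+1 k k.+1 xs ys acts) =
              E i (xs k.+1)
}.

Fixpoint logit_filter (R : realType) (N S : nat) (A : finType)
    (P : A -> 'M[R]_N) (E : 'M[R]_(S, N)) (delta : R) (w0 : 'cV[R]_N)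
    (acts : nat -> A) (ys : nat -> 'I_S) (k : nat) : 'cV[R]_N :=
  if k is k'.+1 then
    P (acts k') *m ((1 - delta) *: logit_filter P E delta w0 acts ys k')
    + delta *: map_mx (@ln R) (E^T *m delta_mx (ys k) 0)
  else w0.

(* xhat k is a maximizer of w_k; the tie-breaking rule is arbitrary. *)
Definition is_logit_estimate (R : realType) (N S : nat) (A : finType)
    (P : A -> 'M[R]_N) (E : 'M[R]_(S, N)) (delta : R) (w0 : 'cV[R]_N)
    (M : process R N S A) (xhat : nat -> Omega M -> 'I_N) : Prop :=
  rv_measurable xhat /\
  forall k w i,
    let wk := logit_filter P E delta w0 (act M ^~ w) (obs M ^~ w) k in
    wk i 0 <= wk (xhat k w) 0.

(* The steady-state error limsup_k p_k. *)
Definition limsup_error (R : realType) (N S : nat) (A : finType)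
    (M : process R N S A) (xhat : nat -> Omega M -> 'I_N) : \bar R :=
  limn_esup (fun k => prob M [set w | xhat k w != state M k w]).

(* M eps and xhat eps are the model and the estimates for the parameter eps;
   the process, in particular the policy, may depend on eps. *)
Definition slow_family (R : realType) (N S : nat) (A : finType)
    (P Q : A -> 'M[R]_N) (E : 'M[R]_(S, N)) (pi0 w0 : 'cV[R]_N)
    (delta : R -> R) (M : R -> process R N S A)
    (xhat : forall eps, nat -> Omega (M eps) -> 'I_N) : Prop :=
  [/\ (forall a, perturbation_of (P a) (Q a)),
      column_stochastic pi0 &
      \forall eps \near 0^'+,
        [/\ (forall a, column_stochastic (transition P Q eps a)),
            0 < delta eps < 1,
            is_hmm (transition P Q eps) E pi0 (M eps) &
            is_logit_estimate P E (delta eps) w0 (xhat eps)]].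

(* Main.v *)
Require Import Defs.
From HB Require Import structures.
From mathcomp Require Import fingroup perm.
From mathcomp Require Import all_boot all_order all_algebra.
From mathcomp Require Import all_classical all_reals all_analysis.
From mathcomp Require Import ring lra.

Set Implicit Arguments.
Unset Strict Implicit.
Unset Printing Implicit Defensive.

Import Order.TTheory GRing.Theory Num.Theory.
Import numFieldNormedType.Exports.

Local Open Scope classical_set_scope.
Local Open Scope ring_scope.

(* Trace a competing state i backwards along the permutations of the actions
   and compare its weight with that of the true state.  As long as the state
   itself follows the permutations, the gap w(i) - w(x) contracts by 1 - delta
   at each step and receives delta times a log-likelihood ratio, which has
   negative mean.  Over a window of m ~ K / delta steps the initial gap is
   forgotten, and a Chernoff bound with exponent 1 / (2 delta) makes the error
   probability at most N exp (- c / (4 delta)), unless the state has jumped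
   inside the window, which has probability at most m eps C.  The sum
   eps C (K / delta + 1) + N exp (- c / (4 delta)) yields both claims; in (b)
   the exponential is at most eps as soon as lambda <= c / 4. *)

(** * Chernoff bound for log-likelihood ratios *)

(** The tangent of [expR] at v d lies below the graph at 0 and at d; averaging these two
    inequalities with weights 1 - v and v cancels the slopes. *)
Lemma expR_le_chord (R : realType) (v d : R) : 0 <= v <= 1 ->
  expR (v * d) <= 1 - v + v * expR d.
Proof.
move=> /andP[v0 v1]; set e := expR (v * d); have e0 : 0 < e := expR_gt0 _.
have h1 : e * (1 - v * d) <= 1.
  have := expR_ge1Dx (- (v * d)); rewrite expRN -/e => h.
  have := ler_wpM2l (ltW e0) h; rewrite divff ?gt_eqF//.
have h2 : e * (1 + (1 - v) * d) <= expR d.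
  have -> : expR d = e * expR ((1 - v) * d).
    by rewrite /e -expRD; congr expR; ring.
  by rewrite ler_pM2l// expR_ge1Dx.
have h3 := ler_wpM2l v0 h2.
have h4 : (1 - v) * (e * (1 - v * d)) <= (1 - v) * 1.
  by rewrite ler_wpM2l// subr_ge0.
have -> : e = (1 - v) * (e * (1 - v * d)) + v * (e * (1 + (1 - v) * d)) by ring.
lra.
Qed.

Definition log_ratio (R : realType) (N S : nat) (E : 'M[R]_(S, N)) (y : 'I_S)
  (i x : 'I_N) : R := ln (E y i) - ln (E y x).

(* The exponential moment is convex in u, equals 1 at u = 0, and at u = 1/2 is
   one minus half the squared Hellinger distance H between the two columns. *)
Lemma chernoff_rate (R : realType) (N S : nat) (E : 'M[R]_(S, N)) :
  column_stochastic E -> (forall i j, 0 < E i j) ->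
  (forall j j', j != j' -> col j E != col j' E) ->
  exists2 c : R, 0 < c & forall x i u, i != x -> 0 <= u <= 2^-1 ->
    \sum_y E y x * expR (u * log_ratio E y i x) <= expR (- (c * u)).
Proof.
move=> [_ E1] E0 Ecol.
pose rt y i := expR (2^-1 * ln (E y i)).
have rtE y i : rt y i ^+ 2 = E y i.
  rewrite /rt expr2 -expRD -mulrDl -[in RHS](@lnK _ (E y i)) ?posrE//.
  by congr expR; field.
pose H (p : 'I_N * 'I_N) := \sum_y (rt y p.1 - rt y p.2) ^+ 2.
have Hpos p : p.1 != p.2 -> 0 < H p.
  move=> /Ecol; rewrite lt_neqAle sumr_ge0 ?andbT; last by move=> *; exact: sqr_ge0.
  apply: contraNneq => /esym/eqP.
  rewrite psumr_eq0 => [/allP h|*]; last exact: sqr_ge0.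
  apply/eqP/colP => y; rewrite !mxE -!rtE; congr (_ ^+ 2).
  by apply/eqP; rewrite -subr_eq0 -sqrf_eq0; apply: h; rewrite mem_index_enum.
(* The default value 1 keeps c positive when there are no two distinct states. *)
pose c := \big[Num.min/1]_(p | p.1 != p.2) H p.
exists c.
  by apply/bigmin_gtP; split=> // p; exact: Hpos.
move=> x i u ix /andP[u0 u1].
have cH : c <= H (i, x) by exact: bigmin_le_cond.
have Hb : \sum_y E y x * expR (2^-1 * log_ratio E y i x) = 1 - 2^-1 * H (i, x).
  transitivity (\sum_y rt y i * rt y x).
    apply: eq_bigr => y _; rewrite /log_ratio mulrBr expRB -/(rt y i) -/(rt y x).
    by rewrite -rtE; field; rewrite gt_eqF ?expR_gt0.
  have h : \sum_y (rt y i - rt y x) ^+ 2 =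
           \sum_y E y i + \sum_y E y x - 2 * \sum_y rt y i * rt y x.
    rewrite mulr_sumr -big_split -sumrB.
    by apply: eq_bigr => y _ /=; rewrite -!rtE; ring.
  by rewrite /H /= h !E1; field.
(* Chord between the exponents 0 and 1/2, with weight 2 u: the moment is at most 1 - u H, hence at
   most 1 - c u. *)
apply: (@le_trans _ _ (\sum_y E y x *
    (1 - 2 * u + 2 * u * expR (2^-1 * log_ratio E y i x)))).
  apply: ler_sum => y _; rewrite ler_pM2l//.
  have -> : u * log_ratio E y i x = 2 * u * (2^-1 * log_ratio E y i x) by field.
  by apply: expR_le_chord; apply/andP; split; lra.
have -> : \sum_y E y x *
      (1 - 2 * u + 2 * u * expR (2^-1 * log_ratio E y i x)) =
    (1 - 2 * u) * \sum_y E y x +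
    2 * u * \sum_y E y x * expR (2^-1 * log_ratio E y i x).
  by rewrite !mulr_sumr -big_split; apply: eq_bigr => y _ /=; ring.
rewrite E1 Hb; have := expR_ge1Dx (- (c * u)).
have := ler_wpM2r u0 cH; nra.
Qed.

(** * Finite partitions and upper limits *)

Lemma prob_partition (R : realType) d (Om : measurableType d)
    (Pr : probability Om R) (V : finType) (Z : Om -> V) (B : set Om) :
  (forall v, measurable (Z @^-1` [set v])) -> measurable B ->
  fine (Pr B) = \sum_v fine (Pr (B `&` Z @^-1` [set v])).
Proof.
move=> mZ mB.
have mBv v : measurable (B `&` Z @^-1` [set v]) by exact: measurableI.
have BE : B = \bigcup_(v in [set` index_enum V]) (B `&` Z @^-1` [set v]).
  apply/seteqP; split=> [w Bw|w [v _ []//]].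
  by exists (Z w) => //=; exact: mem_index_enum.
rewrite sum_fine; last by move=> v _; exact: fin_num_measure.
congr fine; rewrite {1}BE measure_fin_bigcup//; first last.
- by move=> v v' _ _ [w [[_ /= <-] [_ /= <-]]].
- by rewrite -fsbig_seq// index_enum_uniq.
Qed.

Lemma limn_esup_le_near (R : realType) (u : (\bar R)^nat) (b : \bar R) (m : nat) :
  (forall k, (m <= k)%N -> (u k <= b)%E) -> (limn_esup u <= b)%E.
Proof.
move=> ub; rewrite /limn_esup limf_esupE.
apply: (@le_trans _ _ (ereal_sup (u @` [set k | (m <= k)%N]))).
  by apply: ereal_inf_lbound => /=; exists [set k | (m <= k)%N] => //; exists m.
by apply: ge_ereal_sup => _ [k /= mk <-]; exact: ub.
Qed.

(** * Finite prefixes of trajectories *)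

Record hmm_path (N S : nat) (A : Type) := Path {
  pstate : nat -> 'I_N;
  pobs : nat -> 'I_S;
  pact : nat -> A
}.

Section Paths.
Variables (N S : nat) (A : Type).
Implicit Types h : hmm_path N S A.

(** These coordinates determine the state and the filter at time k; the action at time k is not yet
    chosen. *)
Definition agree (k : nat) (h h' : hmm_path N S A) : Prop :=
  [/\ (forall l, (l <= k)%N -> pstate h l = pstate h' l),
      (forall l, (1 <= l <= k)%N -> pobs h l = pobs h' l) &
      (forall l, (l < k)%N -> pact h l = pact h' l)].

(* The values of b only fill the coordinates not yet reached: start and extend
   set every coordinate on which agree depends. *)
Definition start (b : hmm_path N S A) (x : 'I_N) : hmm_path N S A :=
  Path (fun l => if l == 0 then x else pstate b l) (pobs b) (pact b).

Definition extend (k : nat) h (t : A * 'I_N * 'I_S) : hmm_path N S A :=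
  Path (fun l => if l == k.+1 then t.1.2 else pstate h l)
       (fun l => if l == k.+1 then t.2 else pobs h l)
       (fun l => if l == k then t.1.1 else pact h l).

Lemma agree_extend k h t : agree k (extend k h t) h.
Proof.
split=> l; rewrite /= ?ltnS.
- by move=> lk; rewrite ltn_eqF// ltnS.
- by move=> /andP[_ lk]; rewrite ltn_eqF// ltnS.
- by move=> lk; rewrite ltn_eqF.
Qed.

Lemma agree_le k l h h' : (l <= k)%N -> agree k h h' -> agree l h h'.
Proof.
move=> lk [h1 h2 h3]; split=> j.
- by move=> /leq_trans/(_ lk)/h1.
- by move=> /andP[j1 /leq_trans/(_ lk) jk]; apply: h2; rewrite j1.
- by move=> /leq_trans/(_ lk)/h3.
Qed.

End Paths.

(** * Expectations over prefixes *)

Section PathExpectation.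
Variables (R : realType) (N S : nat) (A : finType) (M : process R N S A).
Variables (T : A -> 'M[R]_N) (E : 'M[R]_(S, N)) (pi0 : 'cV[R]_N).
Hypothesis hM : is_hmm T E pi0 M.
Hypothesis hT : forall a, column_stochastic (T a).
Hypothesis hE : column_stochastic E.
Hypothesis hpi0 : column_stochastic pi0.
Implicit Types (h : hmm_path N S A) (f g : hmm_path N S A -> R) (B : set (Omega M)).

Let pr B : R := fine (prob M B).

Definition traj (w : Omega M) : hmm_path N S A :=
  Path (state M ^~ w) (obs M ^~ w) (act M ^~ w).

Definition cyl (k : nat) h : set (Omega M) := [set w | agree k (traj w) h].

Lemma measurable_history k m n xs ys acts :
  measurable (history (M:=M) k m n xs ys acts).
Proof.
have -> : history (M:=M) k m n xs ys acts =
    (\bigcap_(l in [set l | (l <= k)%N]) (state M l @^-1` [set xs l])) `&`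
    (\bigcap_(l in [set l | (1 <= l <= m)%N]) (obs M l @^-1` [set ys l])) `&`
    (\bigcap_(l in [set l | (l < n)%N]) (act M l @^-1` [set acts l])).
  by apply/seteqP; split=> [w []//|w [[]]].
apply: measurableI; first apply: measurableI.
- by apply: bigcap_measurableType => l _; exact: (state_measurable hM).
- by apply: bigcap_measurableType => l _; exact: (obs_measurable hM).
- by apply: bigcap_measurableType => l _; exact: (act_measurable hM).
Qed.

Lemma measurable_cyl k h : measurable (cyl k h).
Proof. exact: measurable_history. Qed.

Let pr_ge0 B : 0 <= pr B.
Proof. exact: fine_ge0. Qed.

Let le_pr B B' : measurable B -> measurable B' -> B `<=` B' -> pr B <= pr B'.
Proof.
move=> mB mB' BB'; apply: fine_le; rewrite ?fin_num_measure//.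
by apply: le_measure => //; rewrite inE.
Qed.

(** Multiplication rule free of the positivity condition: on a null event both sides vanish. *)
Let pr_cond (F B : set (Omega M)) (p : R) : measurable F -> measurable B ->
  ((0 < prob M B)%E -> cond_prob (M:=M) F B = p) -> pr (F `&` B) = pr B * p.
Proof.
move=> mF mB; have [B0|] := ltP 0%E (prob M B).
  move=> /(_ isT) <-; rewrite /cond_prob mulrC divfK// gt_eqF//.
  by apply: fine_gt0; rewrite B0 ltey_eq fin_num_measure.
rewrite measure_le0 => /eqP B0 _.
have h0 : pr B = 0 by rewrite /pr B0.
rewrite h0 mul0r; apply/eqP; rewrite eq_le pr_ge0 andbT -h0.
by apply: le_pr => //; exact: measurableI.
Qed.

Let q k h a := pr (cyl k h `&` act M k @^-1` [set a]).

Lemma sum_act_prob k h : \sum_a q k h a = pr (cyl k h).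
Proof.
by rewrite /pr (prob_partition _ (act_measurable hM k) (measurable_cyl k h)).
Qed.

(** The nesting follows the chronology, latest event outermost, so that [pr_cond] strips one factor
    at a time. *)
Lemma cyl_extend k h a x y : cyl k.+1 (extend k h (a, x, y)) =
  obs M k.+1 @^-1` [set y] `&` (state M k.+1 @^-1` [set x] `&`
    (cyl k h `&` act M k @^-1` [set a])).
Proof.
apply/seteqP; split=> [w [/= h1 h2 h3]|w [/= wy [wx [[/= h1 h2 h3] wa]]]].
  split; first by have := h2 k.+1 (leqnn _); rewrite eqxx.
  split; first by have := h1 k.+1 (leqnn _); rewrite eqxx.
  split; last by have := h3 k (leqnn _); rewrite eqxx.
  split=> l.
  - by move=> lk; have := h1 l (leqW lk); rewrite ltn_eqF.
  - move=> /andP[l1 lk]; have := h2 l; rewrite l1 (leqW lk) ltn_eqF//; exact.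
  - by move=> lk; have := h3 l (leqW lk); rewrite ltn_eqF.
split=> l /=.
- by rewrite leq_eqVlt; case: eqP => [->//|_ /= lk]; exact: h1.
- by rewrite [(l <= k.+1)%N]leq_eqVlt; case: eqP => [->//|_ /= lk]; exact: h2.
- by rewrite ltnS leq_eqVlt; case: eqP => [->//|_ /= lk]; exact: h3.
Qed.

(** The action stays inside the joint weight [q], because later bounds are uniform over the action
    chosen. *)
Lemma cyl_extend_prob k h a x y :
  pr (cyl k.+1 (extend k h (a, x, y))) = q k h a * (T a x (pstate h k) * E y x).
Proof.
pose h' := extend k h (a, x, y); rewrite cyl_extend.
have [e1 e2 e3] : agree k h' h by exact: agree_extend.
have hk : pstate h' k = pstate h k by rewrite e1.
have hk1 : pstate h' k.+1 = x by rewrite /h' /= eqxx.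
have ak : pact h' k = a by rewrite /h' /= eqxx.
clearbody h'.
(* The conditioning events of [state_law] and [obs_law], read off from h', are the intersections
   left by [cyl_extend]. *)
have H1 : history (M:=M) k k k.+1 (pstate h') (pobs h') (pact h') =
    cyl k h `&` act M k @^-1` [set a].
  apply/seteqP; split=> [w [h1 h2 h3]|w [[/= h1 h2 h3] wa]].
    split; last by rewrite /= h3.
    split=> l /= lk; [by rewrite h1// e1 | by rewrite h2// e2 |].
    by rewrite h3 ?e3// ltnS ltnW.
  split=> l lk; [by rewrite e1// -h1 | by rewrite e2// -h2 |].
  move: lk; rewrite ltnS leq_eqVlt => /predU1P[->|lk]; first by rewrite ak.
  by rewrite e3// -h3.
have H2 : history (M:=M) k.+1 k k.+1 (pstate h') (pobs h') (pact h') =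
    state M k.+1 @^-1` [set x] `&` (cyl k h `&` act M k @^-1` [set a]).
  rewrite -H1; apply/seteqP; split=> [w [h1 h2 h3]|w [wx [h1 h2 h3]]].
    split; first by rewrite /= h1.
    by split=> // l lk; rewrite h1// leqW.
  split=> // l; rewrite leq_eqVlt => /predU1P[->|lk]; first by rewrite hk1.
  by rewrite h1.
have mact : measurable (act M k @^-1` [set a]) by exact: (act_measurable hM).
have mst : measurable (state M k.+1 @^-1` [set x]) by exact: (state_measurable hM).
have mob : measurable (obs M k.+1 @^-1` [set y]) by exact: (obs_measurable hM).
have mcyl := measurable_cyl k h.
rewrite (pr_cond (p := E y x)) => [||| H0]; first last.
- rewrite -H2 in H0 *; rewrite -[X in _ = E y X]hk1; exact: (obs_law hM).
- by apply: measurableI => //; exact: measurableI.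
- by [].
rewrite (pr_cond (p := T a x (pstate h k))) => [||| H0]; first last.
- rewrite -H1 in H0 *; rewrite -[X in _ = T _ _ X]hk -[X in _ = T X _ _]ak.
  exact: (state_law hM).
- exact: measurableI.
- by [].
by rewrite mulrA.
Qed.

Variable b : hmm_path N S A.

(** The last step is folded into the summand, so a one-step estimate of the integrand passes
    directly to the whole sum. *)
Fixpoint path_sum (k : nat) f : R :=
  if k is k'.+1 then path_sum k' (fun h => \sum_t f (extend k' h t))
  else \sum_x f (start b x).

Lemma ler_path_sum k f g : (forall h, f h <= g h) -> path_sum k f <= path_sum k g.
Proof.
elim: k f g => [|k IH] f g fg /=; first exact: ler_sum.
by apply: IH => h; exact: ler_sum.
Qed.

Lemma path_sumD k f g :
  path_sum k (fun h => f h + g h) = path_sum k f + path_sum k g.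
Proof.
elim: k f g => [|k IH] f g /=; first by rewrite big_split.
by rewrite -IH; congr path_sum; apply/funext => h; rewrite big_split.
Qed.

Lemma path_sumZ k c f :
  path_sum k (fun h => c * f h) = c * path_sum k f.
Proof.
elim: k f => [|k IH] f /=; first by rewrite mulr_sumr.
by rewrite -IH; congr path_sum; apply/funext => h; rewrite mulr_sumr.
Qed.

(** When f depends only on the prefix up to k, this is the expectation of f along the random
    trajectory. *)
Definition expect k f : R := path_sum k (fun h => pr (cyl k h) * f h).

Lemma ler_expect k f g : (forall h, f h <= g h) -> expect k f <= expect k g.
Proof. by move=> fg; apply: ler_path_sum => h; rewrite ler_wpM2l. Qed.

Lemma expectD k f g : expect k (fun h => f h + g h) = expect k f + expect k g.
Proof.
by rewrite /expect -path_sumD; congr path_sum; apply/funext => h; rewrite mulrDr.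
Qed.

Lemma expectZ k c f : expect k (fun h => c * f h) = c * expect k f.
Proof.
by rewrite /expect -path_sumZ; congr path_sum; apply/funext => h; rewrite mulrCA.
Qed.

(** The one-step bound is required for each action separately; averaging it with the weights [q],
    whose sum is the cylinder probability, covers every policy. *)
Lemma ler_expect_step k f g :
  (forall h a, \sum_x T a x (pstate h k) * \sum_y E y x * f (extend k h (a, x, y))
     <= g h) ->
  expect k.+1 f <= expect k g.
Proof.
move=> fg; rewrite /expect /=; apply: ler_path_sum => h.
rewrite -sum_act_prob mulr_suml.
have -> : \sum_t pr (cyl k.+1 (extend k h t)) * f (extend k h t) =
    \sum_a q k h a *
      \sum_x T a x (pstate h k) * \sum_y E y x * f (extend k h (a, x, y)).
  transitivity (\sum_a \sum_x \sum_y
      pr (cyl k.+1 (extend k h (a, x, y))) * f (extend k h (a, x, y))).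
    by rewrite !pair_bigA /=; apply: eq_bigr => -[[a x] y] _.
  apply: eq_bigr => a _; rewrite mulr_sumr; apply: eq_bigr => x _.
  rewrite !mulr_sumr; apply: eq_bigr => y _.
  by rewrite cyl_extend_prob; ring.
by apply: ler_sum => a _; apply: ler_wpM2l; [exact: pr_ge0|exact: fg].
Qed.

Lemma ler_expect_cst k c : 0 <= c -> expect k (fun=> c) <= c.
Proof.
move=> c0; elim: k => [|k IH]; last first.
  apply: le_trans IH; apply: ler_expect_step => h a.
  rewrite -[leRHS]mul1r -((hT a).2 (pstate h k)) mulr_suml ler_sum// => x _.
  by rewrite -mulr_suml hE.2 mul1r.
rewrite /expect /= -mulr_suml -[leRHS]mul1r ler_wpM2r//.
rewrite -(hpi0.2 0) ler_sum// => x _.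
have -> : pi0 x 0 = pr (state M 0 @^-1` [set x]) by rewrite /pr (init_law hM).
apply: le_pr; [exact: measurable_cyl | exact: (state_measurable hM) |].
by move=> w [/= h1 _ _]; rewrite h1.
Qed.

(** Splitting each cylinder by the next action, state and observation keeps the family of cylinders
    covering. *)
Lemma path_sum_cover k B : measurable B ->
  pr B <= path_sum k (fun h => pr (B `&` cyl k h)).
Proof.
move=> mB; elim: k => [|k IH] /=.
  rewrite /pr (prob_partition _ (state_measurable hM 0) mB) ler_sum// => x _.
  apply: le_pr; [|exact: measurableI _ (measurable_cyl 0 _)|].
    by apply: measurableI => //; exact: (state_measurable hM).
  move=> w [Bw wx]; split=> //; split=> l //=; first by rewrite leqn0 => /eqP->.
  by rewrite leqn0 => /andP[/gtn_eqF ->].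
apply: (le_trans IH); apply: ler_path_sum => h.
have mBc : measurable (B `&` cyl k h).
  by apply: measurableI => //; exact: measurable_cyl.
pose Z w := (act M k w, state M k.+1 w, obs M k.+1 w).
have ZE t : Z @^-1` [set t] = obs M k.+1 @^-1` [set t.2] `&`
    (state M k.+1 @^-1` [set t.1.2] `&` act M k @^-1` [set t.1.1]).
  case: t => [[a x] y]; apply/seteqP.
  by split=> [w [<- <- <-]//|w [/= <- [<- <-]]].
have mZ t : measurable (Z @^-1` [set t]).
  rewrite ZE; apply: measurableI; first exact: (obs_measurable hM).
  by apply: measurableI; [exact: (state_measurable hM)|exact: (act_measurable hM)].
rewrite /pr (prob_partition _ mZ mBc); apply: ler_sum => t _.
apply: le_pr; [exact: measurableI|apply: measurableI => //; exact: measurable_cyl|].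
by case: t => [[a x] y]; rewrite ZE cyl_extend => w [[Bw cw] [wy [wx wa]]].
Qed.

(** Markov's inequality. Since f is evaluated at the enumerated h and not at the trajectory, the
    bound 1 is required of every h agreeing with it. *)
Lemma prob_le_expect k B f : measurable B -> (forall h, 0 <= f h) ->
  (forall w h, B w -> agree k (traj w) h -> 1 <= f h) ->
  pr B <= expect k f.
Proof.
move=> mB f0 f1; apply: (le_trans (path_sum_cover k mB)).
apply: ler_path_sum => h.
have [->|/set0P[w [Bw cw]]] := eqVneq (B `&` cyl k h) set0.
  by rewrite {1}/pr measure0 mulr_ge0.
apply: (@le_trans _ _ (pr (cyl k h))); last by rewrite ler_peMr// (f1 w).
apply: le_pr; [apply: measurableI => // | |exact: subIsetr];
  exact: measurable_cyl.
Qed.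

End PathExpectation.

(** * The filter along a path *)

Section Filter.
Variables (R : realType) (N S : nat) (A : finType).
Variables (P : A -> 'M[R]_N) (E : 'M[R]_(S, N)) (w0 : 'cV[R]_N) (delta : R).
Hypothesis hP : forall a, is_perm_mx (P a).
Hypothesis hdelta : 0 < delta < 1.
Implicit Types h : hmm_path N S A.

Definition filt h (k : nat) (i : 'I_N) : R :=
  logit_filter P E delta w0 (pact h) (pobs h) k i 0.

Lemma filt_agree k h h' : agree k h h' -> filt h k =1 filt h' k.
Proof.
rewrite /filt => hh i; congr (fun_of_matrix _ i 0).
elim: k hh => [//|k IH] hh /=.
rewrite IH; last exact: agree_le hh.
by have [_ e2 e3] := hh; rewrite e2 ?leqnn// e3.
Qed.

(** Left multiplication by [perm_mx s] moves entry s i to place i: s sends a state to its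
    predecessor. *)
Lemma filt_extend k h a s x y i : P a = perm_mx s ->
  filt (extend k h (a, x, y)) k.+1 i =
  (1 - delta) * filt h k (s i) + delta * ln (E y i).
Proof.
move=> Pas; have /(_ (s i)) := filt_agree (agree_extend k h (a, x, y)).
rewrite /filt /= !eqxx Pas -row_permE -colE !mxE => ->.
by [].
Qed.

(** A crude bound, but independent of delta and of the path, hence constant as eps tends to 0. *)
Definition filt_bound : R := \sum_y \sum_i `|ln (E y i)| + \sum_i `|w0 i 0|.

Lemma filt_bound_ge0 : 0 <= filt_bound.
Proof. by rewrite addr_ge0 ?sumr_ge0// => y _; rewrite sumr_ge0. Qed.

(** Each update is a convex combination of a previous entry and a log-likelihood, both within the
    bound. *)
Lemma norm_filt h k i : `|filt h k i| <= filt_bound.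
Proof.
have lnB y j : `|ln (E y j)| <= filt_bound.
  rewrite /filt_bound (bigD1 y)//= (bigD1 j)//= -!addrA lerDl.
  by rewrite !addr_ge0 ?sumr_ge0// => y' _; rewrite sumr_ge0.
elim: k i => [|k IH] i.
  rewrite /filt /= /filt_bound addrC (bigD1 i)//= -!addrA lerDl.
  by rewrite !addr_ge0 ?sumr_ge0// => y' _; rewrite sumr_ge0.
have /is_perm_mxP[s Pas] := hP (pact h k).
rewrite {1}/filt /= Pas -row_permE -colE !mxE.
have /andP[d0 d1] := hdelta.
apply: (le_trans (ler_normD _ _)); rewrite !normrM (ger0_norm (ltW d0)).
have e0 : 0 <= 1 - delta by rewrite subr_ge0 ltW.
rewrite (ger0_norm e0).
have -> : filt_bound = (1 - delta) * filt_bound + delta * filt_bound by ring.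
apply: lerD; apply: ler_wpM2l => //; last exact: ltW.
exact: IH.
Qed.

(** Times are written r + k0 so that incrementing r yields the successor on which [expect]
    recurses. *)
Fixpoint no_jump (k0 r : nat) h : bool :=
  if r is r'.+1 then
    no_jump k0 r' h &&
    (P (pact h (r' + k0)%N) (pstate h (r' + k0).+1) (pstate h (r' + k0)%N) == 1)
  else true.

Lemma no_jump_agree k0 r k h h' : (r + k0 <= k)%N -> agree k h h' ->
  no_jump k0 r h = no_jump k0 r h'.
Proof.
elim: r => [//|r IH] rk hh /=; rewrite IH//; last by rewrite ltnW.
by have [e1 _ e3] := hh; rewrite !e1 ?e3// ltnW.
Qed.

Lemma no_jump_extend k0 r h a x y :
  no_jump k0 r.+1 (extend (r + k0) h (a, x, y)) =
  no_jump k0 r h && (P a x (pstate h (r + k0)%N) == 1).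
Proof.
rewrite /= !eqxx (no_jump_agree (leqnn _) (agree_extend _ _ _)).
by rewrite ltn_eqF.
Qed.

(** The union bound over competitors is built in: for th >= 0, an estimation error makes some
    summand at least 1. *)
Definition gap_moment (th : R) (k : nat) h : R :=
  \sum_(i | i != pstate h k) expR (th * (filt h k i - filt h k (pstate h k))).

Lemma gap_moment_ge0 th k h : 0 <= gap_moment th k h.
Proof. by rewrite sumr_ge0// => i _; exact: expR_ge0. Qed.

End Filter.

(** * Jumps and exponential moments over a window *)

Section Window.
Variables (R : realType) (N S : nat) (A : finType) (M : process R N S A).
Variables (P Q : A -> 'M[R]_N) (E : 'M[R]_(S, N)) (pi0 w0 : 'cV[R]_N).
Variables (eps delta c : R).
Let T := transition P Q eps.
Hypothesis hP : forall a, is_perm_mx (P a).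
Hypothesis eps0 : 0 <= eps.
Hypothesis hdelta : 0 < delta < 1.
Hypothesis hM : is_hmm T E pi0 M.
Hypothesis hT : forall a, column_stochastic (T a).
Hypothesis hE : column_stochastic E.
Hypothesis hpi0 : column_stochastic pi0.
Hypothesis hc : forall x i u, i != x -> 0 <= u <= 2^-1 ->
  \sum_y E y x * expR (u * log_ratio E y i x) <= expR (- (c * u)).
Variable b : hmm_path N S A.
Implicit Types h : hmm_path N S A.

Let Ex := expect M b.
Local Notation filt := (filt P E w0 delta).
Local Notation gap_moment := (gap_moment P E w0 delta).
Local Notation no_jump := (no_jump P).

Definition jump_rate : R := \sum_a \sum_j \sum_i `|Q a i j|.

(** Union bound over the r steps: where [P a] vanishes, the transition probability is just eps times
    the entry of [Q a]. *)
Lemma expect_jump k0 r :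
  Ex (r + k0)%N (fun h => (~~ no_jump k0 r h)%:R) <= r%:R * (eps * jump_rate).
Proof.
have C0 : 0 <= eps * jump_rate.
  rewrite mulr_ge0// !sumr_ge0// => a _; rewrite sumr_ge0// => j _.
  by rewrite sumr_ge0.
elim: r => [|r IH].
  by rewrite mul0r; exact: (ler_expect_cst hM hT hE hpi0).
apply: (@le_trans _ _ (Ex (r + k0)%N
    (fun h => (~~ no_jump k0 r h)%:R + eps * jump_rate))).
  rewrite addSn; apply: (ler_expect_step hM) => h a.
  set x0 := pstate h _.
  have -> : \sum_x T a x x0 * (\sum_y E y x *
      (~~ no_jump k0 r.+1 (extend (r + k0) h (a, x, y)))%:R) =
    \sum_x T a x x0 * (~~ (no_jump k0 r h && (P a x x0 == 1)))%:R.
    apply: eq_bigr => x _; congr (_ * _).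
    rewrite -[RHS]mul1r -[X in _ = X * _](hE.2 x) mulr_suml; apply: eq_bigr => y _.
    by rewrite no_jump_extend.
  case: (no_jump k0 r h) => /=; last first.
    rewrite (eq_bigr (fun x => T a x x0)) => [|x _]; last by rewrite mulr1.
    by rewrite (hT a).2 lerDl.
  rewrite add0r.
  apply: (@le_trans _ _ (\sum_x eps * `|Q a x x0|)).
    apply: ler_sum => x _; have [//|Px] := eqVneq (P a x x0) 1.
      by rewrite mulr0 mulr_ge0.
    rewrite mulr1; have /is_perm_mxP[s Pas] := hP a.
    move: Px; rewrite /T /transition !mxE Pas !mxE.
    case: (s x =P x0) => [_|_ _]; first by rewrite eqxx.
    by rewrite add0r ler_wpM2l// ler_norm.
  rewrite -mulr_sumr ler_wpM2l// /jump_rate.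
  apply: (@le_trans _ _ (\sum_j \sum_i `|Q a i j|)).
    by rewrite [leRHS](bigD1 x0)//= lerDl sumr_ge0// => j _; rewrite sumr_ge0.
  rewrite [leRHS](bigD1 a)//= lerDl sumr_ge0// => ? _.
  by rewrite sumr_ge0// => j _; rewrite sumr_ge0.
rewrite /Ex expectD -natr1 mulrDl mul1r lerD//.
exact: (ler_expect_cst hM hT hE hpi0).
Qed.

(* Dividing the exponent by 1 - delta at each step compensates the contraction
   of the gaps, so that the moments satisfy a multiplicative recursion. *)
Lemma expect_gap_moment k0 t r :
  0 <= t -> t / (1 - delta) ^+ r * delta <= 2^-1 ->
  Ex (r + k0)%N (fun h => (no_jump k0 r h)%:R *
      gap_moment (t / (1 - delta) ^+ r) (r + k0) h)
  <= N%:R * expR (2 * filt_bound E w0 * t - c * (t / (1 - delta) ^+ r - t)).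
Proof.
move=> t0; have /andP[d0 d1] := hdelta.
have e0 : 0 < 1 - delta by rewrite subr_gt0.
elim: r => [_|r IH].
  (* At the start of the window the gaps are controlled only by [2 * filt_bound]. *)
  rewrite expr0 divr1 subrr mulr0 subr0 add0n.
  apply: (le_trans _ (ler_expect_cst hM hT hE hpi0 b k0 _)); last first.
    by rewrite mulr_ge0// expR_ge0.
  apply: ler_expect => h; rewrite mul1r /gap_moment.
  apply: (@le_trans _ _ (\sum_(i < N) expR (2 * filt_bound E w0 * t))); last first.
    by rewrite sumr_const card_ord -[leLHS]mulr_natl.
  rewrite big_mkcond /= ler_sum// => i _; case: ifP => _; last exact: expR_ge0.
  rewrite ler_expR mulrC ler_wpM2r//.
  have := norm_filt E w0 hP hdelta h k0 i.
  have := norm_filt E w0 hP hdelta h k0 (pstate h k0).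
  by rewrite !ler_norml => /andP[? ?] /andP[? ?]; lra.
set th := t / (1 - delta) ^+ r in IH *.
have thS : t / (1 - delta) ^+ r.+1 = th / (1 - delta).
  by rewrite /th exprS; field; rewrite expf_neq0 gt_eqF.
rewrite thS; set th' := th / (1 - delta) => hth'.
have thE : th = (1 - delta) * th' by rewrite /th'; field; rewrite gt_eqF.
have th'0 : 0 <= th' by rewrite !divr_ge0 ?exprn_ge0// ltW.
have {}IH := IH _.
(* One step gains the Chernoff factor at u = th' delta. As th' delta = th' - th, the exponents
   telescope. *)
apply: (@le_trans _ _ (expR (- (c * (th' * delta))) *
    Ex (r + k0)%N
      (fun h => (no_jump k0 r h)%:R * gap_moment th (r + k0) h))); last first.
  apply: (@le_trans _ _ (expR (- (c * (th' * delta))) *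
      (N%:R * expR (2 * filt_bound E w0 * t - c * (th - t))))).
    by rewrite ler_wpM2l ?expR_ge0// IH// thE; nra.
  by rewrite mulrCA -expRD thE ler_wpM2l// ler_expR; lra.
rewrite addSn /Ex -expectZ; apply: (ler_expect_step hM) => h a.
have /is_perm_mxP[s Pas] := hP a.
set x0 := pstate h _.
case g : (no_jump k0 r h); last first.
  rewrite mul0r mulr0 big1// => x _; rewrite big1 ?mulr0// => y _.
  by rewrite no_jump_extend g mul0r mulr0.
rewrite mul1r.
(* Column x0 of the permutation matrix leaves a single successor x1 without a jump. *)
have PE x : (P a x x0 == 1) = (x == s^-1%g x0).
  rewrite Pas !mxE; have -> : (x == s^-1%g x0) = (s x == x0).
    by rewrite (can2_eq (permK s) (permKV s)).
  by case: (s x == x0); rewrite ?eqxx// eq_sym oner_eq0.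
set x1 := (s^-1%g x0) in PE; have sx1 : s x1 = x0 by rewrite permKV.
rewrite (@big_only1 _ _ _ _ x1) => // [|x xx1 _]; last first.
  rewrite big1 ?mulr0// => y _.
  by rewrite no_jump_extend g PE (negbTE xx1) mul0r mulr0.
set Y := \sum_y _.
(* With th = (1 - delta) th', the old gap keeps exponent th and the average over the new observation
   factors out. *)
have YE : Y = \sum_(i | i != x1)
    expR (th * (filt h (r + k0) (s i) - filt h (r + k0) x0)) *
    \sum_y E y x1 * expR (th' * delta * log_ratio E y i x1).
  under [RHS]eq_bigr do rewrite mulr_sumr.
  rewrite exchange_big /=; apply: eq_bigr => y _.
  rewrite no_jump_extend g PE eqxx mul1r /gap_moment {1}/pstate /= eqxx mulr_sumr.
  apply: eq_bigr => i _; rewrite mulrCA -expRD; congr (_ * expR _).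
  by rewrite !(filt_extend _ _ _ _ _ _ _ _ Pas) sx1 /log_ratio thE; ring.
have Y0 : 0 <= Y.
  rewrite YE sumr_ge0// => i _; rewrite mulr_ge0 ?expR_ge0// sumr_ge0// => y _.
  by rewrite mulr_ge0 ?expR_ge0// hE.1.
(* The probability of moving to x1 is bounded by 1. *)
apply: (@le_trans _ _ Y).
  rewrite -[leRHS]mul1r ler_wpM2r// -((hT a).2 x0) (bigD1 x1)//= lerDl.
  by rewrite sumr_ge0// => x _; exact: (hT a).1.
rewrite YE /gap_moment [leRHS]mulrC.
(* Competitors of x0 are indexed by their successors: s i differs from x0 exactly when i differs
   from x1. *)
rewrite [in X in _ <= X](reindex_inj (@perm_inj _ s)) /= [leRHS]mulr_suml.
rewrite [leRHS](eq_bigl (fun i => i != x1)) => [|i]; last first.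
  by rewrite -/x0 -sx1 (inj_eq perm_inj).
apply: ler_sum => i ix; rewrite ler_wpM2l ?expR_ge0//.
by apply: hc => //; rewrite hth' mulr_ge0// ltW.
Qed.

Variable xhat : nat -> Omega M -> 'I_N.
Hypothesis hxhat : is_logit_estimate P E delta w0 xhat.

(** Take the last m steps before k as the window. On an error, either a jump occurred in it or some
    competitor has a nonnegative final gap; F is at least 1 in both cases. *)
Lemma error_le m t k : (m <= k)%N -> 0 <= t ->
  t / (1 - delta) ^+ m * delta <= 2^-1 ->
  (prob M [set w | xhat k w != state M k w] <=
   (m%:R * (eps * jump_rate) +
    N%:R * expR (2 * filt_bound E w0 * t - c * (t / (1 - delta) ^+ m - t)))%:E)%E.
Proof.
move=> mk t0 ht; set th := t / _; pose k0 := (k - m)%N.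
have mk0 : (m + k0)%N = k by rewrite subnKC.
have th0 : 0 <= th.
  by rewrite divr_ge0// exprn_ge0// subr_ge0; case/andP: hdelta => _ /ltW.
set B := [set w | _].
have mB : measurable B.
  have -> : B = \bigcup_(ij in [set` [set ij : 'I_N * 'I_N | ij.1 != ij.2]%SET])
      (xhat k @^-1` [set ij.1] `&` state M k @^-1` [set ij.2]).
    apply/seteqP; split=> [w /= Bw|w [[i j]]]; last first.
      by rewrite /= inE /B /= => ij [-> ->].
    by exists (xhat k w, state M k w) => //=; rewrite inE.
  apply: fin_bigcup_measurable => [|ij _]; first exact: finite_finset.
  by apply: measurableI; [exact: hxhat.1 | exact: (state_measurable hM)].
rewrite -(fineK (fin_num_measure _ _ mB)) lee_fin.
pose F h : R := (~~ no_jump k0 m h)%:R + (no_jump k0 m h)%:R * gap_moment th k h.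
apply: (@le_trans _ _ (Ex k F)).
  apply: (prob_le_expect hM) => // [h|w h /= Bw [hst hob hac]].
    by rewrite addr_ge0// mulr_ge0// gap_moment_ge0.
  rewrite /F; case: (no_jump k0 m h); rewrite /= ?mul0r ?addr0// add0r mul1r.
  have sE : state M k w = pstate h k by rewrite -hst.
  have fE i : filt h k i = filt (traj w) k i.
    by apply: filt_agree; split=> l lk; rewrite (hst, hob, hac).
  rewrite /gap_moment (bigD1 (xhat k w)) /=; last by rewrite -sE.
  rewrite -[leLHS]addr0 lerD//; last by rewrite sumr_ge0// => *; exact: expR_ge0.
  rewrite -expR0 ler_expR mulr_ge0// subr_ge0 !fE.
  exact: (hxhat.2 k w).
rewrite /Ex expectD lerD//.
  by rewrite -mk0; exact: expect_jump.
by rewrite -{1 2}mk0; exact: expect_gap_moment.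
Qed.

End Window.

(** * Window length and steady-state error *)

(* After burn_in / delta steps the initial gap, at most 2 filt_bound, is
   discounted enough to cost only half of the decay rate c. *)
Definition burn_in (R : realType) (N S : nat) (E : 'M[R]_(S, N))
    (w0 : 'cV[R]_N) (c : R) : R :=
  - ln (c / (2 * (2 * filt_bound E w0 + c))).

Lemma burn_in_ge0 (R : realType) (N S : nat) (E : 'M[R]_(S, N))
    (w0 : 'cV[R]_N) (c : R) : 0 < c -> 0 <= burn_in E w0 c.
Proof.
move=> c0; have B0 := filt_bound_ge0 E w0.
by rewrite oppr_ge0 ln_le0// ler_pdivrMr; nra.
Qed.

Lemma limsup_error_le (R : realType) (N S : nat) (A : finType)
    (M : process R N S A) (P Q : A -> 'M[R]_N) (E : 'M[R]_(S, N))
    (pi0 w0 : 'cV[R]_N) (eps delta c : R) (xhat : nat -> Omega M -> 'I_N) :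
  (forall a, is_perm_mx (P a)) -> 0 <= eps -> 0 < delta < 1 ->
  is_hmm (transition P Q eps) E pi0 M ->
  (forall a, column_stochastic (transition P Q eps a)) ->
  column_stochastic E -> column_stochastic pi0 -> 0 < c ->
  (forall x i u, i != x -> 0 <= u <= 2^-1 ->
    \sum_y E y x * expR (u * log_ratio E y i x) <= expR (- (c * u))) ->
  is_logit_estimate P E delta w0 xhat ->
  (limsup_error xhat <=
    ((burn_in E w0 c / delta + 1) * (eps * jump_rate Q) +
     N%:R * expR (- (c / (4 * delta))))%:E)%E.
Proof.
move=> hP eps0 hdelta hM hT hE hpi0 c0 hc hxhat.
have /andP[d0 d1] := hdelta.
have e0 : 0 < 1 - delta by rewrite subr_gt0.
(* A sample point supplies the filler path [traj w] for [error_le]. *)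
have [w _] : exists w : Omega M, [set: Omega M] w.
  apply/set0P/eqP => ST; have := probability_setT (prob M).
  by rewrite ST measure0 => /eqP; rewrite eq_sym onee_eq0.
set K := burn_in E w0 c; have K0 : 0 <= K by exact: burn_in_ge0.
set B := filt_bound E w0; have B0 : 0 <= B by exact: filt_bound_ge0.
pose m := (Num.truncn (K / delta)).+1.
have Kd0 : 0 <= K / delta by rewrite divr_ge0// ltW.
have mK : m%:R <= K / delta + 1 by rewrite -natr1 lerD2r truncn_le.
have Km : K <= delta * m%:R.
  by rewrite mulrC -ler_pdivrMr// ltW// truncnS_gt.
clearbody m.
(* The final exponent becomes 1 / (2 delta), the largest allowed by the constraint u <= 1/2. *)
pose t := (1 - delta) ^+ m / (2 * delta).
have t0 : 0 <= t by rewrite divr_ge0 ?exprn_ge0 ?mulr_ge0// ltW.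
have tm : t / (1 - delta) ^+ m = (2 * delta)^-1.
  by rewrite /t; field; rewrite !gt_eqF ?exprn_gt0.
(* Indeed (1 - delta)^m <= exp (- delta m) <= exp (- K), and K was defined to make the last term
   this quotient. *)
have contr : (1 - delta) ^+ m <= c / (2 * (2 * B + c)).
  apply: (@le_trans _ _ (expR (- K))); last first.
    by rewrite /K /burn_in -/B opprK lnK// posrE divr_gt0//; lra.
  apply: (@le_trans _ _ (expR (- delta) ^+ m)).
    by rewrite lerXn2r ?nnegrE ?expR_ge0 ?(ltW e0)// expR_ge1Dx.
  by rewrite -expRM_natl ler_expR mulrN lerN2 mulrC.
apply: (@limn_esup_le_near _ _ _ m) => k mk.
have hm : t / (1 - delta) ^+ m * delta <= 2^-1.
  by rewrite tm invfM mulfVK// gt_eqF.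
apply: le_trans (error_le hP eps0 hdelta hM hT hE hpi0 hc (traj w) hxhat
  mk t0 hm) _.
rewrite lee_fin; apply: lerD.
  rewrite ler_wpM2r// mulr_ge0// /jump_rate.
  by do 3 (rewrite sumr_ge0// => ? _).
rewrite ler_wpM2l// ler_expR tm -/B.
(* By [contr] the numerator is at most c / 2 - c. *)
have -> : 2 * B * t - c * ((2 * delta)^-1 - t) =
    ((2 * B + c) * (1 - delta) ^+ m - c) / (2 * delta).
  by rewrite /t; field; rewrite gt_eqF.
have -> : - (c / (4 * delta)) = (- (c / 2)) / (2 * delta).
  by field; rewrite gt_eqF.
rewrite ler_wpM2r ?invr_ge0 ?mulr_ge0 ?(ltW d0)//.
have BC : 0 < 2 * B + c by lra.
have := ler_wpM2l (ltW BC) contr.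
have -> : (2 * B + c) * (c / (2 * (2 * B + c))) = c / 2 by field; rewrite gt_eqF.
lra.
Qed.

(** * The two regimes of delta as eps tends to 0 *)

Theorem theorem5p9 (R : realType) (N S : nat) (A : finType)
    (P : A -> 'M[R]_N) (E : 'M[R]_(S, N))
    (hP : forall a, is_perm_mx (P a))
    (hE : column_stochastic E)
    (hE0 : forall i j, 0 < E i j)
    (hEcol : forall j j', j != j' -> col j E != col j' E) :
  (forall (Q : A -> 'M[R]_N) (pi0 w0 : 'cV[R]_N) (delta : R -> R)
      (M : R -> process R N S A)
      (xhat : forall eps, nat -> Omega (M eps) -> 'I_N),
    slow_family P Q E pi0 w0 delta xhat ->
    delta eps @[eps --> 0^'+] --> 0 ->
    eps / delta eps @[eps --> 0^'+] --> 0 ->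
    limsup_error (xhat eps) @[eps --> 0^'+] --> 0%E)
  /\
  (exists2 xi : R, 0 < xi &
    forall (Q : A -> 'M[R]_N) (pi0 w0 : 'cV[R]_N) (delta : R -> R)
      (M : R -> process R N S A)
      (xhat : forall eps, nat -> Omega (M eps) -> 'I_N) (lambda : R),
    slow_family P Q E pi0 w0 delta xhat ->
    0 < lambda < xi ->
    (\forall eps \near 0^'+, delta eps = lambda / ln (1 / eps)) ->
    exists2 kappa : R, 0 < kappa &
    exists2 r : R -> R, r =o_ (0^'+) (fun eps : R => eps * ln (1 / eps)) &
      \forall eps \near 0^'+,
        (limsup_error (xhat eps) <=
           (kappa * (eps * ln (1 / eps)) + r eps)%:E)%E).
Proof.
have [c c0 hc] := chernoff_rate hE hE0 hEcol.
have J0 (Q : A -> 'M[R]_N) : 0 <= jump_rate Q.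
  by rewrite /jump_rate; do 3 (rewrite sumr_ge0// => ? _).
split=> [Q pi0 w0 delta M xhat [_ hpi0 fam] d0 ed0|].
  set K := burn_in E w0 c; have K0 : 0 <= K by exact: burn_in_ge0.
  (* The last term comes from exp (- x) <= 1 / x at x = c / (4 delta). *)
  pose bound e : R := K * jump_rate Q * (e / delta e) + jump_rate Q * e +
    N%:R * 4 / c * delta e.
  apply: (@squeeze_cvge _ _ _ _ (cst 0%E) _ (EFin \o bound)); last 2 first.
  - exact: cvg_cst.
  - apply: cvg_EFin; first by near=> e.
    rewrite [X in _ --> X](_ : 0 = K * jump_rate Q * 0 + jump_rate Q * 0 +
      N%:R * 4 / c * 0); last by rewrite !mulr0 !addr0.
    apply: cvgD; first apply: cvgD; apply: cvgMr => //.
    exact: cvg_at_right_filter.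
  near=> e; have e0 : 0 < e by near: e; exact: nbhs_right_gt.
  case: (near fam e) => // hT hdelta hM hxhat.
  have /andP[dp _] := hdelta.
  rewrite limf_esup_ge0 /=; last first.
  - by move=> k; exact: measure_ge0.
  - exact: filter_not_empty.
  apply: (le_trans (limsup_error_le hP (ltW e0) hdelta hM hT hE hpi0 c0 hc hxhat)).
  rewrite lee_fin /bound; apply: lerD.
    by rewrite -/K le_eqVlt; apply/orP; left; apply/eqP; field; rewrite gt_eqF.
  rewrite -!mulrA ler_wpM2l// expRN.
  have x0 : 0 < c / (4 * delta e) by rewrite divr_gt0// mulr_gt0.
  have -> : 4 * (c^-1 * delta e) = (c / (4 * delta e))^-1.
    by field; rewrite !gt_eqF.
  rewrite lef_pV2 ?posrE ?expR_gt0//.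
  by have := expR_ge1Dx (c / (4 * delta e)); lra.
(* Here c was obtained before Q, w0, the policies and lambda, so xi is uniform in them. *)
exists (c / 4) => [|Q pi0 w0 delta M xhat lambda [_ hpi0 fam] /andP[l0 lc] hd].
  by rewrite divr_gt0.
set K := burn_in E w0 c; have K0 : 0 <= K by exact: burn_in_ge0.
(* In order: the window length, its rounding up, the exponential term, and 1 to ensure
   positivity. *)
exists (K * jump_rate Q / lambda + jump_rate Q + N%:R + 1).
  by rewrite ltr_wpDl// !addr_ge0// divr_ge0 ?mulr_ge0// ltW.
(* The bound holds without remainder once eps < exp (-1): then log (1 / eps) >= 1, and terms of
   order eps are absorbed. *)
exists (cst 0).
  by apply/eqoP => e e0; near=> x; rewrite normr0 mulr_ge0// ltW.
near=> e; have e0 : 0 < e by near: e; exact: nbhs_right_gt.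
have e1 : e < expR (- 1) by near: e; apply: nbhs_right_lt; exact: expR_gt0.
case: (near fam e) => // hT hdelta hM hxhat.
have de : delta e = lambda / ln (1 / e) by apply: (near hd e).
apply: (le_trans (limsup_error_le hP (ltW e0) hdelta hM hT hE hpi0 c0 hc hxhat)).
rewrite lee_fin addr0 -/K de; set L := ln (1 / e).
have L1 : 1 <= L.
  rewrite /L div1r lnV ?posrE// lerNr -ler_expR lnK ?posrE//; exact: ltW.
have expL : expR (- L) = e by rewrite /L div1r lnV ?posrE// opprK lnK.
have expb : expR (- (c / (4 * (lambda / L)))) <= e.
  rewrite -[leRHS]expL ler_expR lerN2.
  have -> : c / (4 * (lambda / L)) = c / (4 * lambda) * L.
    by field; rewrite !gt_eqF//; lra.
  by rewrite ler_peMl ?ler_pdivlMr ?mulr_gt0//; lra.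
have eL : e <= e * L by rewrite ler_peMr// ltW.
have -> : (K / (lambda / L) + 1) * (e * jump_rate Q) =
    K * jump_rate Q / lambda * (e * L) + jump_rate Q * e.
  by field; rewrite !gt_eqF//; lra.
have N0 : 0 <= N%:R :> R by [].
have := ler_wpM2l N0 (le_trans expb eL); have := ler_wpM2l (J0 Q) eL.
have : 0 <= e * L by rewrite mulr_ge0 ?ltW//; lra.
rewrite !mulrDl; lra.
Unshelve. all: by end_near.
Qed.
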